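(* Let $A$ be an involutive residuated lattice in which $\odot =\wedge$. Then the following are equivalent: (i) $A$ has the Boolean Lifting Property (BLP); (ii) the underlying bounded lattice of $A$ is a Boolean algebra; (iii) $A$ is hyperarchimedean.
   Context: A residuated lattice is a commutative integral bounded one: a structure $(A,\vee ,\wedge ,\odot ,\rightarrow ,0,1)$ such that $(A,\vee ,\wedge ,0,1)$ is a bounded lattice, $(A,\odot ,1)$ is a commutative monoid, and $a\leq b\rightarrow c$ iff $a\odot b\leq c$ for all $a,b,c$. Write $\neg a=a\rightarrow 0$, $a\leftrightarrow b=(a\rightarrow b)\wedge (b\rightarrow a)$, and $a^n$ for the $n$-fold $\odot$-power. $A$ is involutive iff $\neg\neg x=x$ for all $x\in A$. $\mathcal{B}(A)$ is the set of complemented elements of the bounded lattice reduct of $A$. $A$ is hyperarchimedean iff for every $a\in A$ there is $n\geq 1$ with $a^n\in \mathcal{B}(A)$. A filter of $A$ is a nonempty subset closed under $\odot$ and upward closed. For a filter $F$, $A/F$ is the quotient residuated lattice by the congruence $a\equiv b$ iff $a\leftrightarrow b\in F$, with classes $a/F$. $F$ has BLP iff for every $f\in \mathcal{B}(A/F)$ there is $e\in \mathcal{B}(A)$ with $e/F=f$. $A$ has BLP iff all its filters have BLP. *)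

(* Defs.v *)
From HB Require Import structures.
From mathcomp Require Import ssreflect ssrfun ssrbool eqtype ssrnat choice seq.
From mathcomp Require Import order.
From mathcomp Require Import generic_quotient boolp classical_sets.

Set Implicit Arguments.
Unset Strict Implicit.
Unset Printing Implicit Defensive.

Import Order.Theory.

Local Open Scope order_scope.
Local Open Scope quotient_scope.

Reserved Notation "x ⊙ y" (at level 40, left associativity).
Reserved Notation "x ⇒ y" (at level 55, right associativity).
Reserved Notation "x ⇔ y" (at level 56, no associativity).

HB.mixin Record TBLattice_isResiduated d (A : Type) of Order.TBLattice d A := {
  odot : A -> A -> A;
  residual : A -> A -> A;
  odotA : associative odot;
  odotC : commutative odot;
  odot1x : left_id \top odot;
  residuation : forall a b c : A, (a <= residual b c) = (odot a b <= c)
}.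

(* Commutative, integral (the unit of odot is the top), bounded.  The trivial
   algebra, with \bot = \top, is allowed. *)
#[short(type="residuatedLatticeType")]
HB.structure Definition ResiduatedLattice d :=
  {A of TBLattice_isResiduated d A & Order.TBLattice d A}.

Notation "x ⊙ y" := (odot x y) : order_scope.
Notation "x ⇒ y" := (residual x y) : order_scope.

Section Operations.
Context {d : Order.disp_t} {A : residuatedLatticeType d}.
Implicit Types a b : A.

Definition rneg a : A := a ⇒ \bot.
Definition bires a b : A := (a ⇒ b) `&` (b ⇒ a).
Definition odot_pow a (n : nat) : A := iter n (odot a) \top.

End Operations.

Notation "x ⇔ y" := (bires x y) : order_scope.

Definition involutive_rl d (A : residuatedLatticeType d) : Prop :=
  forall x : A, rneg (rneg x) = x.

Definition complemented_elts d (L : tbLatticeType d) : set L :=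
  [set x : L | exists y : L, x `|` y = \top /\ x `&` y = \bot].
Arguments complemented_elts {d} L _.

Definition boolean_algebra d (L : tbLatticeType d) : Prop :=
  (forall x y z : L, x `&` (y `|` z) = (x `&` y) `|` (x `&` z)) /\
  (forall x : L, complemented_elts L x).

Definition hyperarchimedean d (A : residuatedLatticeType d) : Prop :=
  forall a : A, exists2 n : nat, (1 <= n)%N & complemented_elts A (odot_pow a n).

Record rlFilter d (A : residuatedLatticeType d) := RLFilter {
  rlFilter_set :> A -> Prop;
  rlFilter_nonempty : exists a, rlFilter_set a;
  rlFilter_odot : forall a b,
    rlFilter_set a -> rlFilter_set b -> rlFilter_set (a ⊙ b);
  rlFilter_up : forall a b, rlFilter_set a -> a <= b -> rlFilter_set b
}.

Section ResiduatedTheory.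
Context {d : Order.disp_t} {A : residuatedLatticeType d}.
Implicit Types a b c : A.

Lemma odotx1 a : a ⊙ \top = a.
Proof. by rewrite odotC odot1x. Qed.

Lemma le_odot2r c a b : a <= b -> a ⊙ c <= b ⊙ c.
Proof. by move=> ab; rewrite -residuation (le_trans ab) // residuation. Qed.

Lemma le_odot2l c a b : a <= b -> c ⊙ a <= c ⊙ b.
Proof. by rewrite ![c ⊙ _]odotC; apply: le_odot2r. Qed.

Lemma odot_lel a b : a ⊙ b <= a.
Proof. by rewrite -[leRHS]odotx1 le_odot2l ?lex1. Qed.

Lemma odot_ler a b : a ⊙ b <= b.
Proof. by rewrite odotC odot_lel. Qed.

Lemma odotUr a b c : c ⊙ (a `|` b) = (c ⊙ a) `|` (c ⊙ b).
Proof.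
apply/le_anti; rewrite leUx !le_odot2l ?leUl ?leUr // andbT.
by rewrite odotC -residuation leUx !residuation ![_ ⊙ c]odotC leUl leUr.
Qed.

End ResiduatedTheory.

Section FilterCongruence.
Context {d : Order.disp_t} {A : residuatedLatticeType d}.
Variable F : rlFilter A.
Implicit Types a b c : A.

Definition filter_cong : rel A := fun a b => `[< F (a ⇔ b) >].

Definition filter_le : rel A := fun a b => `[< F (a ⇒ b) >].

Lemma filter_leP a b : reflect (exists2 f, F f & f ⊙ a <= b) (filter_le a b).
Proof.
apply: (iffP (asboolP _)) => [Fab|[f Ff fab]].
  by exists (a ⇒ b) => //; rewrite -residuation.
by apply: rlFilter_up Ff _; rewrite residuation.
Qed.

Lemma le_filter_le a b : a <= b -> filter_le a b.
Proof.
move=> ab; have [f Ff] := rlFilter_nonempty F; apply/filter_leP; exists f => //.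
exact: le_trans (odot_ler _ _) ab.
Qed.

Lemma filter_le_refl : reflexive filter_le.
Proof. by move=> a; apply: le_filter_le. Qed.

Lemma filter_le_trans : transitive filter_le.
Proof.
move=> b a c /filter_leP[f Ff fab] /filter_leP[g Fg gbc].
apply/filter_leP; exists (g ⊙ f); first exact: rlFilter_odot.
by rewrite -odotA (le_trans _ gbc) // le_odot2l.
Qed.

Lemma filter_congE a b : filter_cong a b = filter_le a b && filter_le b a.
Proof.
apply/asboolP/andP => [Fab|[/asboolP Fab /asboolP Fba]].
  by split; apply/asboolP; apply: (rlFilter_up Fab); rewrite ?leIl ?leIr.
by apply: (rlFilter_up (rlFilter_odot Fab Fba)); rewrite lexI odot_lel odot_ler.
Qed.

Lemma filter_cong_refl : reflexive filter_cong.
Proof. by move=> a; rewrite filter_congE filter_le_refl. Qed.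

Lemma filter_cong_sym : symmetric filter_cong.
Proof. by move=> a b; rewrite !filter_congE andbC. Qed.

Lemma filter_cong_trans : transitive filter_cong.
Proof.
move=> b a c; rewrite !filter_congE => /andP[ab ba] /andP[bc cb].
by rewrite (filter_le_trans ab bc) (filter_le_trans cb ba).
Qed.

Canonical filter_cong_equiv :=
  EquivRel filter_cong filter_cong_refl filter_cong_sym filter_cong_trans.

Lemma filter_leI a b c :
  filter_le a (b `&` c) = filter_le a b && filter_le a c.
Proof.
apply/idP/andP => [abc|[/filter_leP[f Ff fab] /filter_leP[g Fg gac]]].
  by split; apply: (filter_le_trans abc); rewrite le_filter_le ?leIl ?leIr.
apply/filter_leP; exists (f ⊙ g); first exact: rlFilter_odot.
rewrite lexI (le_trans _ fab) ?(le_trans _ gac) ?le_odot2r //.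
  exact: odot_ler.
exact: odot_lel.
Qed.

Lemma filter_leU a b c :
  filter_le (a `|` b) c = filter_le a c && filter_le b c.
Proof.
apply/idP/andP => [abc|[/filter_leP[f Ff fac] /filter_leP[g Fg gbc]]].
  by split; apply: filter_le_trans abc; rewrite le_filter_le ?leUl ?leUr.
apply/filter_leP; exists (f ⊙ g); first exact: rlFilter_odot.
rewrite odotUr leUx (le_trans _ fac) ?(le_trans _ gbc) ?le_odot2r //.
  exact: odot_ler.
exact: odot_lel.
Qed.

Lemma filter_le_residual a b c : filter_le a (b ⇒ c) = filter_le (a ⊙ b) c.
Proof.
by apply/filter_leP/filter_leP => -[f Ff fab]; exists f => //;
  move: fab; rewrite residuation odotA.
Qed.

Lemma filter_le_odot2 a a' b b' :
  filter_le a a' -> filter_le b b' -> filter_le (a ⊙ b) (a' ⊙ b').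
Proof.
move=> aa' bb'; rewrite -filter_le_residual (filter_le_trans aa') //.
rewrite filter_le_residual odotC -filter_le_residual (filter_le_trans bb') //.
by rewrite filter_le_residual odotC filter_le_refl.
Qed.

Definition rlquot := {eq_quot filter_cong_equiv}.
HB.instance Definition _ := Choice.on rlquot.
HB.instance Definition _ := EqQuotient.on rlquot.

Definition rlclass (a : A) : rlquot := \pi_rlquot a.

Implicit Types u v w : rlquot.

Definition quot_le u v : bool := filter_le (repr u) (repr v).
Definition quot_meet u v : rlquot := rlclass (repr u `&` repr v).
Definition quot_join u v : rlquot := rlclass (repr u `|` repr v).
Definition quot_odot u v : rlquot := rlclass (repr u ⊙ repr v).
Definition quot_residual u v : rlquot := rlclass (repr u ⇒ repr v).

Lemma rlclassP a b : rlclass a = rlclass b <-> F (a ⇔ b).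
Proof. by split => [/eqmodP/asboolP //|Fab]; apply/eqmodP/asboolP. Qed.

Lemma repr_rlclassP a :
  filter_le (repr (rlclass a)) a && filter_le a (repr (rlclass a)).
Proof. by rewrite -filter_congE; apply/asboolP/rlclassP; exact: reprK. Qed.

Lemma quot_le_class a b : quot_le (rlclass a) (rlclass b) = filter_le a b.
Proof.
have /andP[ra ar] := repr_rlclassP a; have /andP[rb br] := repr_rlclassP b.
apply/idP/idP => ab.
  exact: filter_le_trans (filter_le_trans ar ab) rb.
exact: filter_le_trans (filter_le_trans ra ab) br.
Qed.

Lemma quot_ind (P : rlquot -> Prop) : (forall a, P (rlclass a)) -> forall u, P u.
Proof. by move=> Pa u; rewrite -[u]reprK. Qed.

Lemma quot_le_refl : reflexive quot_le.
Proof. by move=> u; apply: filter_le_refl. Qed.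

Lemma quot_le_anti : antisymmetric quot_le.
Proof.
elim/quot_ind=> a; elim/quot_ind=> b; rewrite !quot_le_class -filter_congE.
by move=> /asboolP /rlclassP.
Qed.

Lemma quot_le_trans : transitive quot_le.
Proof. by move=> v u w; apply: filter_le_trans. Qed.

HB.instance Definition _ :=
  Order.Le_isPOrder.Build d rlquot quot_le_refl quot_le_anti quot_le_trans.

Lemma quot_meetP u v w : quot_le u (quot_meet v w) = quot_le u v && quot_le u w.
Proof.
by elim/quot_ind: u => a; rewrite quot_le_class filter_leI -!quot_le_class /rlclass !reprK.
Qed.

Lemma quot_joinP u v w : quot_le (quot_join u v) w = quot_le u w && quot_le v w.
Proof.
by elim/quot_ind: w => a; rewrite quot_le_class filter_leU -!quot_le_class /rlclass !reprK.
Qed.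

HB.instance Definition _ :=
  Order.POrder_MeetJoin_isLattice.Build d rlquot quot_meetP quot_joinP.

Lemma quot_le0x u : quot_le (rlclass \bot) u.
Proof. by elim/quot_ind: u => a; rewrite quot_le_class le_filter_le ?le0x. Qed.

Lemma quot_lex1 u : quot_le u (rlclass \top).
Proof. by elim/quot_ind: u => a; rewrite quot_le_class le_filter_le ?lex1. Qed.

HB.instance Definition _ := Order.hasBottom.Build d rlquot quot_le0x.
HB.instance Definition _ := Order.hasTop.Build d rlquot quot_lex1.

Lemma rlclass_odot a b : rlclass (a ⊙ b) = quot_odot (rlclass a) (rlclass b).
Proof.
apply: quot_le_anti; rewrite !quot_le_class.
have /andP[ra ar] := repr_rlclassP a; have /andP[rb br] := repr_rlclassP b.
by rewrite !filter_le_odot2.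
Qed.

Lemma quot_odotA : associative quot_odot.
Proof.
by do 3![elim/quot_ind=> ?]; rewrite -!rlclass_odot odotA.
Qed.

Lemma quot_odotC : commutative quot_odot.
Proof. by do 2![elim/quot_ind=> ?]; rewrite -!rlclass_odot odotC. Qed.

Lemma quot_odot1x : left_id (rlclass \top) quot_odot.
Proof. by elim/quot_ind=> ?; rewrite -rlclass_odot odot1x. Qed.

Lemma quot_residuation u v w :
  quot_le u (quot_residual v w) = quot_le (quot_odot u v) w.
Proof.
elim/quot_ind: u => a; rewrite quot_le_class filter_le_residual.
by rewrite -quot_le_class rlclass_odot /rlclass !reprK.
Qed.

HB.instance Definition _ := TBLattice_isResiduated.Build d rlquot
  quot_odotA quot_odotC quot_odot1x quot_residuation.

End FilterCongruence.

Section QuotientMorphism.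
Context {d : Order.disp_t} {A : residuatedLatticeType d}.
Variable F : rlFilter A.
Implicit Types a b : A.

Lemma rlclass_le a b : (rlclass F a <= rlclass F b) = `[< F (a ⇒ b) >].
Proof. exact: quot_le_class. Qed.

Lemma rlclass0 : rlclass F \bot = \bot. Proof. by []. Qed.

Lemma rlclass1 : rlclass F \top = \top. Proof. by []. Qed.

Lemma rlclassM a b : rlclass F (a ⊙ b) = rlclass F a ⊙ rlclass F b.
Proof. exact: rlclass_odot. Qed.

Lemma rlclassI a b : rlclass F (a `&` b) = rlclass F a `&` rlclass F b.
Proof.
have le_classI u :
    (u <= rlclass F (a `&` b)) = (u <= rlclass F a) && (u <= rlclass F b).
  by elim/(@quot_ind _ _ F): u => c; rewrite ![_ <= _]quot_le_class filter_leI.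
by apply/le_anti/andP; split; rewrite ?le_classI ?leIl ?leIr // lexI -le_classI.
Qed.

Lemma rlclassU a b : rlclass F (a `|` b) = rlclass F a `|` rlclass F b.
Proof.
have le_classU u :
    (rlclass F (a `|` b) <= u) = (rlclass F a <= u) && (rlclass F b <= u).
  by elim/(@quot_ind _ _ F): u => c; rewrite ![_ <= _]quot_le_class filter_leU.
by apply/le_anti/andP; split; rewrite ?le_classU ?leUl ?leUr // leUx -le_classU.
Qed.

Lemma rlclass_residual a b : rlclass F (a ⇒ b) = rlclass F a ⇒ rlclass F b.
Proof.
have le_class_res u :
    (u <= rlclass F (a ⇒ b)) = (u ⊙ rlclass F a <= rlclass F b).
  elim/(@quot_ind _ _ F): u => c; rewrite -rlclassM ![_ <= _]quot_le_class.
  exact: filter_le_residual.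
by apply/le_anti/andP; split; rewrite ?le_class_res -?residuation // residuation
  -le_class_res.
Qed.

End QuotientMorphism.

Definition filter_BLP d (A : residuatedLatticeType d) (F : rlFilter A) : Prop :=
  forall f : rlquot F, complemented_elts (rlquot F) f ->
  exists2 e : A, complemented_elts A e & rlclass F e = f.

Definition BLP d (A : residuatedLatticeType d) : Prop :=
  forall F : rlFilter A, filter_BLP F.

(* Main.v *)
Require Import Defs.
From mathcomp Require Import ssreflect order.
From mathcomp Require Import ssrfun ssrbool ssrnat generic_quotient.

(** Under the two hypotheses all three conditions simply hold.  When
[odot] is the meet, residuation makes [A] a Heyting algebra, and an involutive
Heyting algebra is Boolean: the element [x `|` rneg x] has pseudocomplement
below [rneg x `&` rneg (rneg x)], which is [\bot], so involutivity forces it to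
be [\top] ([lem_of_meet]); distributivity is that of [odot] over joins
([boolean_of_meet]).  Once every element is complemented, any representative of
a class lifts it ([complemented_BLP]), and the exponent 1 witnesses
hyperarchimedeanity ([complemented_hyperarchimedean]). *)

Import Order.Theory.
Local Open Scope order_scope.

Section Residuated.
Context {d : Order.disp_t} {A : residuatedLatticeType d}.
Implicit Types x y : A.

Lemma odot_rneg x : x ⊙ rneg x = \bot.
Proof. by apply: le_anti; rewrite le0x andbT odotC -residuation lexx. Qed.

Lemma rneg_anti x y : x <= y -> rneg y <= rneg x.
Proof.
move=> xy; rewrite /rneg residuation.
by apply: le_trans (le_odot2l _ xy) _; rewrite -residuation.
Qed.

Lemma rneg0 : rneg (\bot : A) = \top.
Proof. by apply: le_anti; rewrite lex1 residuation odot1x lexx. Qed.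

Lemma complemented_BLP : (forall x, complemented_elts A x) -> BLP A.
Proof.
move=> compl F f _; exists (repr f); first exact: compl.
exact: reprK.
Qed.

Lemma complemented_hyperarchimedean :
  (forall x, complemented_elts A x) -> hyperarchimedean A.
Proof. by move=> compl x; exists 1%N => //; apply: compl. Qed.

Section InvolutiveMeet.
Hypothesis hinv : involutive_rl A.
Hypothesis hmeet : forall x y, x ⊙ y = x `&` y.

Lemma lem_of_meet x : x `|` rneg x = \top.
Proof.
have neg0 : rneg (x `|` rneg x) = \bot.
  apply: le_anti; rewrite le0x andbT -(odot_rneg (rneg x)) hmeet lexI.
  by rewrite !rneg_anti ?leUl ?leUr.
by rewrite -[LHS]hinv neg0 rneg0.
Qed.

Lemma boolean_of_meet : boolean_algebra A.
Proof.
split=> [x y z|x]; first by rewrite -!hmeet odotUr.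
by exists (rneg x); rewrite lem_of_meet -hmeet odot_rneg.
Qed.

End InvolutiveMeet.
End Residuated.

Theorem corollary4p24 (d : Order.disp_t) (A : residuatedLatticeType d)
    (hinv : involutive_rl A)
    (hmeet : forall x y : A, x ⊙ y = x `&` y) :
  (BLP A <-> boolean_algebra A) /\ (boolean_algebra A <-> hyperarchimedean A).
Proof.
have boolA : boolean_algebra A := boolean_of_meet hinv hmeet.
have [_ compl] := boolA.
by split; split=> // _;
  [exact: complemented_BLP | exact: complemented_hyperarchimedean].
Qed.
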